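(* Let $V(x)=\left(\sum_{n=1}^{\infty}b_nx^n\right)\frac{\partial}{\partial x}$ be an analytic vector field with coefficients $b_n\in K$ (that is, $\sum_{n\ge1} b_nx^n\in\mathcal{O}_0^K$), and suppose that $V$ generates a formal flow $\{T_V^t(x)\}_{t\in K}$. Then this flow is analytic, i.e. $T_V^t(x)\in\mathcal{O}_0^K$ for every $t\in K$.
   Context: $K$ is a field of characteristic $0$, complete with respect to a nontrivial non-archimedean absolute value $|\cdot|$. $\mathcal{O}_0^K$ is the ring of power series in $K[[x]]$ with positive radius of convergence about $0$. Formal flow: write $V(x)=v(x)\frac{\partial}{\partial x}$ with $v(x)\in xK[[x]]$. The formal flow of $V$ is the series $T_V^t(x)=\sum_{n\ge1}a_n(t)x^n$ obtained by solving, by purely formal (anti)differentiation in $t$, the differential equations $$\frac{dT_V^t}{dt}(x)=v(T_V^t(x)),\qquad T_V^0(x)=x,$$ so that each $a_n(t)$ is a formal power series in $t$ over $K$. One says that $V$ generates a formal flow $\{T_V^t\}_{t\in K}$ if every $a_n(t)$ can be evaluated (converges) at every $t\in K$, so that $T^t_V\in K[[x]]$ is defined for all $t\in K$ with $T_V^0=\mathrm{id}$ and $T_V^{t_1}\circ T_V^{t_2}=T_V^{t_1+t_2}$. (When $b_1=0$, every $a_n(t)$ is a polynomial in $t$.) *)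

(* Defs.v *)
From HB Require Import structures.
From mathcomp Require Import all_boot all_order all_algebra.
From mathcomp Require Import all_classical all_reals all_analysis.
Set Implicit Arguments.
Unset Strict Implicit.
Unset Printing Implicit Defensive.
Import Order.TTheory GRing.Theory Num.Theory.
Import numFieldNormedType.Exports.
Local Open Scope classical_set_scope.
Local Open Scope ring_scope.

(** * Formal power series *)

(* [f : fps A] is the series whose coefficient of X^n is [f n]. It is a wrapper
   rather than an alias of [nat -> A], since functions already carry a pointwise
   product. *)
Record fps (A : Type) := Fps { coef_fps :> nat -> A }.

HB.instance Definition _ (A : Type) := [isNew for @coef_fps A].
HB.instance Definition _ (A : Type) := gen_eqMixin (fps A).
HB.instance Definition _ (A : Type) := gen_choiceMixin (fps A).

Lemma fpsP (A : Type) (f g : fps A) : (forall n, f n = g n) <-> f = g.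
Proof.
split=> [fg|-> //]; case: f g fg => [f] [g] /= fg.
by congr Fps; apply/funext.
Qed.

Section FpsRing.
Variable A : comNzRingType.
Implicit Types f g h : fps A.

Definition fps_zero : fps A := Fps (fun _ => 0).
Definition fps_opp f : fps A := Fps (fun n => - f n).
Definition fps_add f g : fps A := Fps (fun n => f n + g n).
Definition fpsC (c : A) : fps A := Fps (fun n => if n == 0%N then c else 0).
Definition fpsX : fps A := Fps (fun n => (n == 1%N)%:R).
Definition fps_mul f g : fps A :=
  Fps (fun n => \sum_(i < n.+1) f i * g (n - i)%N).

Let trunc N f : {poly A} := \poly_(i < N) f i.

Let coef_trunc N f i : (i < N)%N -> (trunc N f)`_i = f i.
Proof. by move=> iN; rewrite coef_poly iN. Qed.

Let coef_mulE N n f g (p q : {poly A}) : (n < N)%N ->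
    (forall i, (i < N)%N -> p`_i = f i) -> (forall i, (i < N)%N -> q`_i = g i) ->
  (p * q)`_n = fps_mul f g n.
Proof.
move=> nN pf qg; rewrite coefM; apply: eq_bigr => i _.
rewrite pf ?qg //; first exact: leq_ltn_trans (leq_subr _ _) nN.
by apply: leq_trans nN; exact: ltn_ord.
Qed.

Fact fps_addA : associative fps_add.
Proof. by move=> f g h; apply/fpsP => n /=; rewrite addrA. Qed.
Fact fps_addC : commutative fps_add.
Proof. by move=> f g; apply/fpsP => n /=; rewrite addrC. Qed.
Fact fps_add0 : left_id fps_zero fps_add.
Proof. by move=> f; apply/fpsP => n /=; rewrite add0r. Qed.
Fact fps_addN : left_inverse fps_zero fps_opp fps_add.
Proof. by move=> f; apply/fpsP => n /=; rewrite addNr. Qed.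
HB.instance Definition _ :=
  GRing.isZmodule.Build (fps A) fps_addA fps_addC fps_add0 fps_addN.

Fact fps_mulA : associative fps_mul.
Proof.
move=> f g h; apply/fpsP => n; pose t := trunc n.+1.
have tE k i : (i < n.+1)%N -> (t k)`_i = k i by exact: coef_trunc.
have tME k l i : (i < n.+1)%N -> (t k * t l)`_i = fps_mul k l i.
  by move=> iN; apply: (coef_mulE iN); exact: tE.
rewrite -(@coef_mulE n.+1 n f (fps_mul g h) (t f) (t g * t h)) //;
  [|exact: tE|exact: tME].
rewrite -(@coef_mulE n.+1 n (fps_mul f g) h (t f * t g) (t h)) //;
  [|exact: tME|exact: tE].
by rewrite mulrA.
Qed.
Fact fps_mulC : commutative fps_mul.
Proof.
move=> f g; apply/fpsP => n; pose t := trunc n.+1.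
have tE k i : (i < n.+1)%N -> (t k)`_i = k i by exact: coef_trunc.
rewrite -(@coef_mulE n.+1 n f g (t f) (t g)) //; [|exact: tE|exact: tE].
rewrite -(@coef_mulE n.+1 n g f (t g) (t f)) //; [|exact: tE|exact: tE].
by rewrite mulrC.
Qed.
Fact fps_mul1 : left_id (fpsC 1) fps_mul.
Proof.
move=> f; apply/fpsP => n /=; rewrite big_ord_recl /= mul1r subn0.
by rewrite big1 ?addr0 // => i _; rewrite mul0r.
Qed.
Fact fps_mulDl : left_distributive fps_mul fps_add.
Proof.
move=> f g h; apply/fpsP => n /=; rewrite -big_split.
by apply: eq_bigr => i _; rewrite mulrDl.
Qed.
Fact fps_oner_neq0 : fpsC 1 != fps_zero :> fps A.
Proof.
apply/eqP => /fpsP /(_ 0%N) /= /eqP; apply/negP; exact: oner_neq0.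
Qed.
HB.instance Definition _ := GRing.Zmodule_isComNzRing.Build (fps A)
  fps_mulA fps_mulC fps_mul1 fps_mulDl fps_oner_neq0.

Definition fps_deriv f : fps A := Fps (fun n => f n.+1 *+ n.+1).

(* Composition f(g(X)), meant for [g 0 = 0]: then g^k has order at least k, so
   that only the terms with k <= n contribute to the coefficient of X^n. *)
Definition fps_comp f g : fps A :=
  Fps (fun n => \sum_(k < n.+1) f k * (g ^+ k) n).

End FpsRing.
Arguments fpsX {A}.

Definition fps_map (A B : Type) (phi : A -> B) (f : fps A) : fps B :=
  Fps (fun n => phi (f n)).

(** * Complete non-archimedean fields *)

Section ValuedField.
Variables (R : realType) (K : fieldType) (abs : K -> R).

Definition abs_cvg (u : nat -> K) (l : K) : Prop :=
  (fun n => abs (u n - l)) @ \oo --> (0 : R).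

Definition abs_cauchy (u : nat -> K) : Prop :=
  forall e : R, 0 < e -> exists N : nat, forall m n : nat,
    (N <= m)%N -> (N <= n)%N -> abs (u m - u n) < e.

Record nonarch_absolute_value : Prop := {
  abs_ge0 : forall x, 0 <= abs x;
  abs_eq0 : forall x, abs x = 0 <-> x = 0;
  absM : forall x y, abs (x * y) = abs x * abs y;
  abs_ultrametric : forall x y, abs (x + y) <= Num.max (abs x) (abs y) }.

Definition nontrivial_abs : Prop := exists2 x : K, x != 0 & abs x != 1.

Definition complete_abs : Prop :=
  forall u : nat -> K, abs_cauchy u -> exists l : K, abs_cvg u l.

Definition fps_has_value (f : fps K) (x l : K) : Prop :=
  abs_cvg (series (fun n => f n * x ^+ n)) l.

Definition fps_converges_at (f : fps K) (x : K) : Prop :=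
  exists l : K, fps_has_value f x l.

(* Radius of the largest ball of K on which the series converges. If the value
   group is discrete it can exceed the Cauchy-Hadamard radius, but for a
   nontrivial absolute value both are positive for the same series. *)
Definition convergence_radius (f : fps K) : \bar R :=
  ereal_sup [set r%:E | r in
    [set r : R | 0 <= r /\ forall x : K, abs x < r -> fps_converges_at f x]].

(* Membership in the ring O_0^K. *)
Definition fps_analytic (f : fps K) : Prop := (0 < convergence_radius f)%E.

End ValuedField.

(** * Formal flows *)

(* The vector field v(x) d/dx is represented by [v : fps K]. A series
   T = sum_n a_n(t) x^n in K[[t]][[x]] is represented by [a : fps (fps K)], so
   that [a n m] is the coefficient of x^n t^m; the derivative with respect to t
   therefore acts on each [a n]. *)
Record is_formal_flow (K : fieldType) (v : fps K) (a : fps (fps K)) : Prop := {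
  formal_flow_no_cst : a 0%N = 0;
  formal_flow_ode :
    fps_map (@fps_deriv K) a = fps_comp (fps_map (@fpsC K) v) a;
  formal_flow_init : fps_map (fun f : fps K => f 0%N) a = fpsX }.

(* [T t] is the series obtained by evaluating every a_n at t. *)
Definition generates_formal_flow (R : realType) (K : fieldType) (abs : K -> R)
    (v : fps K) (T : K -> fps K) : Prop :=
  exists a : fps (fps K),
    [/\ is_formal_flow v a,
        forall (n : nat) (t : K), fps_has_value abs (a n) t (T t n),
        T 0 = fpsX
      & forall t1 t2 : K, fps_comp (T t1) (T t2) = T (t1 + t2)].

(* Main.v *)
Require Import Defs.
From mathcomp Require Import all_boot all_order all_algebra.
From mathcomp Require Import all_classical all_reals all_analysis.
From mathcomp Require Import ring zify.
Import Order.TTheory GRing.Theory Num.Theory.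
Import numFieldNormedType.Exports.
Local Open Scope ring_scope.

(* The first coefficient of the flow is a_1(t) = exp(b_1 t), which diverges at
   t = 1 / b_1; hence b_1 = 0. Then a_n(t) is a polynomial of degree less than n
   in t, and with |b_n| <= B c^n the equation for the flow shows, by induction
   on m, that the coefficient of t^m / m! in a_n(t) has absolute value at most
   c^(n-1) (B c)^m. Since |m!| >= q^m for some q > 0, |a_n(t)| grows at most
   geometrically in n. *)

(** * Coefficientwise formulas in the ring of formal power series *)

Section FpsCoefficients.
Variable A : comNzRingType.
Implicit Types f g : fps A.

Lemma coef_fpsM f g n : (f * g) n = \sum_(i < n.+1) f i * g (n - i)%N.
Proof. by []. Qed.

Lemma coef_fps1 n : (1 : fps A) n = (n == 0%N)%:R.
Proof. by rewrite /= /GRing.one /=; case: eqP. Qed.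

Lemma coef_fps_sum (I : Type) (r : seq I) (P : pred I) (F : I -> fps A) n :
  (\sum_(i <- r | P i) F i) n = \sum_(i <- r | P i) F i n.
Proof. by elim/big_rec2: _ => // i _ y _ <-. Qed.

Lemma coef_fpsCM (c : A) f n : (fpsC c * f) n = c * f n.
Proof.
rewrite coef_fpsM big_ord_recl /= subn0 big1 ?addr0 // => i _.
by rewrite mul0r.
Qed.

End FpsCoefficients.

(** * Ultrametric estimates, convergence of power series and size of factorials *)

Section NonarchAbs.
Context {R : realType} {K : fieldType} {abs : K -> R}.
Hypothesis absK : nonarch_absolute_value abs.

Lemma abs0 : abs 0 = 0.
Proof. exact/(abs_eq0 absK). Qed.

Lemma abs_gt0 x : x != 0 -> 0 < abs x.
Proof.
move=> x0; rewrite lt_def (abs_ge0 absK) andbT.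
by apply: contra x0 => /eqP/(abs_eq0 absK)/eqP.
Qed.

Lemma abs1 : abs 1 = 1.
Proof.
have /lt0r_neq0 a1 := abs_gt0 1 (oner_neq0 K).
by apply: (mulIf a1); rewrite -(absM absK) !mul1r.
Qed.

Lemma absX x n : abs (x ^+ n) = abs x ^+ n.
Proof.
elim: n => [|n IH]; first by rewrite !expr0 abs1.
by rewrite !exprS (absM absK) IH.
Qed.

Lemma absN x : abs (- x) = abs x.
Proof.
have aN1 : abs (-1) = 1.
  apply/eqP; rewrite -(@eqrXn2 _ 2) ?(abs_ge0 absK) //.
  by rewrite -absX sqrrN !expr1n abs1.
by rewrite -mulN1r (absM absK) aN1 mul1r.
Qed.

Lemma absV x : abs x^-1 = (abs x)^-1.
Proof.
have [->|x0] := eqVneq x 0; first by rewrite invr0 abs0 invr0.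
have /lt0r_neq0 a0 := abs_gt0 x x0.
by apply: (mulIf a0); rewrite -(absM absK) !mulVf ?abs1.
Qed.

Lemma abs_sum_le (I : Type) (r : seq I) (P : pred I) (F : I -> K) (B : R) :
  0 <= B -> (forall i, P i -> abs (F i) <= B) ->
  abs (\sum_(i <- r | P i) F i) <= B.
Proof.
move=> B0 FB; elim/big_ind: _ => [|x y xB yB|]; rewrite ?abs0 //.
by apply: le_trans (abs_ultrametric absK x y) _; rewrite ge_max xB.
Qed.

Lemma abs_natr_le1 n : abs n%:R <= 1.
Proof.
by rewrite -[n]card_ord -sumr_const abs_sum_le // => i _; rewrite abs1.
Qed.

Lemma abs_cvg0P (u : nat -> K) : abs_cvg abs u 0 <->
  forall e, 0 < e -> exists N, forall n, (N <= n)%N -> abs (u n) < e.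
Proof.
rewrite /abs_cvg; split=> [/cvgr0Pnorm_lt cu e e0|cu].
  have [N _ Nu] := cu e e0; exists N => n /Nu /=.
  by rewrite subr0 ger0_norm ?(abs_ge0 absK).
apply/cvgr0Pnorm_lt => e /cu[N Nu]; exists N => // n /Nu /=.
by rewrite subr0 ger0_norm ?(abs_ge0 absK).
Qed.

Lemma abs_cvg_shift (u : nat -> K) l :
  abs_cvg abs u l <-> abs_cvg abs (fun n => u n - l) 0.
Proof.
have E : (fun n => abs (u n - l - 0)) = (fun n => abs (u n - l)).
  by apply/funext => n; rewrite subr0.
by rewrite /abs_cvg E.
Qed.

Lemma abs_cvg_le (u : nat -> K) l B :
  (exists N, forall n, (N <= n)%N -> abs (u n) <= B) ->
  abs_cvg abs u l -> abs l <= B.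
Proof.
move=> [N uB] /abs_cvg_shift/abs_cvg0P ul; apply/ler_addgt0Pr => e e0.
have [N' ul'] := ul e e0; set n := maxn N N'.
rewrite -(subKr (u n) l); apply: le_trans (abs_ultrametric absK _ _) _.
have uBn := uB n (leq_maxl _ _); rewrite absN.
rewrite ge_max (le_trans uBn) ?lerDl ?ltW //=.
apply: lt_le_trans (ul' n (leq_maxr _ _)) _.
by rewrite lerDr (le_trans _ uBn) ?(abs_ge0 absK).
Qed.

(** Each term is the difference of two consecutive partial sums, both close to [l]. *)
Lemma fps_has_value_terms_cvg0 (f : fps K) x l :
  fps_has_value abs f x l -> abs_cvg abs (fun n => f n * x ^+ n) 0.
Proof.
move=> /abs_cvg_shift/abs_cvg0P fl; apply/abs_cvg0P => e /fl[N Nf].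
exists N => n Nn.
have -> : f n * x ^+ n = (series (fun n => f n * x ^+ n) n.+1 - l)
                        + - (series (fun n => f n * x ^+ n) n - l).
  by rewrite /series /= big_nat_recr //= opprB addrA subrK addrAC subrr add0r.
apply: le_lt_trans (abs_ultrametric absK _ _) _.
by rewrite absN gt_max !Nf // (leq_trans Nn).
Qed.

Lemma fps_has_value_le (f : fps K) x l B :
  (forall n, abs (f n * x ^+ n) <= B) -> fps_has_value abs f x l -> abs l <= B.
Proof.
move=> fB; apply: abs_cvg_le; exists 0%N => n _.
by apply: abs_sum_le => //; apply: le_trans (fB 0%N); rewrite (abs_ge0 absK).
Qed.

(** By the ultrametric inequality a block of terms is no larger than its largest term, so the
    partial sums are Cauchy. *)
Lemma terms_cvg0_fps_converges (f : fps K) x : complete_abs abs ->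
  abs_cvg abs (fun n => f n * x ^+ n) 0 -> fps_converges_at abs f x.
Proof.
move=> compl /abs_cvg0P f0; apply: compl => e /[dup] e0 /f0[N Nf]; exists N.
have small m n : (N <= m)%N -> (m <= n)%N ->
    abs (series (fun n => f n * x ^+ n) n - series (fun n => f n * x ^+ n) m)
    < e.
  move=> Nm mn; rewrite sub_series_geq // big_nat.
  elim/big_ind: _ => [|y z ye ze|i /andP[mi _]]; first by rewrite abs0.
    by apply: le_lt_trans (abs_ultrametric absK _ _) _; rewrite gt_max ye.
  exact: Nf (leq_trans Nm mi).
move=> m n Nm Nn; have [/small|/ltnW/small] := leqP n m; first exact.
by rewrite -absN opprB; exact.
Qed.

Lemma fps_analytic_of_geometric_bound (f : fps K) (D : R) : complete_abs abs ->
  0 < D -> (forall n, abs (f n) <= D ^+ n) -> fps_analytic abs f.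
Proof.
move=> compl D0 fD; apply: lt_le_trans (_ : (D^-1%:E <= _)%E).
  by rewrite lte_fin invr_gt0.
apply: ereal_sup_ubound; exists D^-1 => //=; split.
  by rewrite invr_ge0 ltW.
move=> x xD; apply: terms_cvg0_fps_converges => //; apply/abs_cvg0P => e e0.
have Dx0 : 0 <= D * abs x by rewrite mulr_ge0 ?(abs_ge0 absK) // ltW.
have Dx1 : `|D * abs x| < 1 by rewrite ger0_norm // -ltr_pdivlMl // mulr1.
have /cvgr0Pnorm_lt/(_ e e0)[N _ Ne] := cvg_expr Dx1.
exists N => n /Ne /=; apply: le_lt_trans.
rewrite ger0_norm ?exprn_ge0 // (absM absK) absX exprMn.
by rewrite ler_wpM2r // exprn_ge0 // (abs_ge0 absK).
Qed.

Lemma exists_small_abs (r : R) : nontrivial_abs abs -> 0 < r ->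
  exists2 x, x != 0 & abs x < r.
Proof.
move=> [y y0 y1] r0.
(* Replacing [y] by its inverse if necessary; high powers of [y] are then small. *)
wlog lt1 : y y0 y1 / abs y < 1.
  move=> W; have [|y1'|/eqP] := ltgtP (abs y) 1; first exact: W.
  2: by rewrite (negPf y1).
  have yV : abs y^-1 < 1 by rewrite absV invf_lt1 ?abs_gt0.
  by apply: (W y^-1); rewrite ?invr_eq0 // lt_eqF.
have {}lt1 : `|abs y| < 1 by rewrite ger0_norm ?(abs_ge0 absK).
have /cvgr0Pnorm_lt/(_ r r0)[N _ /(_ N (leqnn N)) /=] := cvg_expr lt1.
rewrite -absX ger0_norm ?(abs_ge0 absK) // => yN.
by exists (y ^+ N) => //; rewrite expf_neq0.
Qed.

(** The terms at one nonzero point [x] of convergence tend to 0, hence are bounded; dividing by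
    [abs x ^+ n] bounds the coefficients. *)
Lemma fps_analytic_geometric_bound (f : fps K) : nontrivial_abs abs ->
  fps_analytic abs f ->
  exists B c : R, [/\ 0 < B, 0 < c & forall n, abs (f n) <= B * c ^+ n].
Proof.
move=> ntr /ereal_sup_gt[_ [r [_ fr] <-]]; rewrite lte_fin => r0.
have [x x0 /fr[l /fps_has_value_terms_cvg0/abs_cvg0P fx]] :=
  exists_small_abs r ntr r0.
have [N Nf] := fx 1 ltr01.
pose S := \sum_(i < N) abs (f i * x ^+ i).
have S0 : 0 <= S by apply: sumr_ge0 => i _; exact: (abs_ge0 absK).
(* [S] dominates the first [N] terms and 1 all later ones. *)
exists (1 + S), (abs x)^-1; split=> [||n]; first by rewrite ltr_wpDr.
  by rewrite invr_gt0 abs_gt0.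
rewrite exprVn ler_pdivlMr ?exprn_gt0 ?abs_gt0 // -absX -(absM absK).
have [nN|/Nf/ltW fn] := ltnP n N; last by rewrite (le_trans fn) // lerDl.
rewrite ler_wpDl // /S (bigD1 (Ordinal nN)) //= lerDl.
by apply: sumr_ge0 => i _; exact: (abs_ge0 absK).
Qed.

(* For [p] the residue characteristic, [|(p k)!| = |p|^k |k!|], and the
   valuation of [m!] is therefore at most linear in [m]. *)
Lemma abs_fact_ge : [pchar K] =i pred0 ->
  exists2 q : R, 0 < q & forall m, q ^+ m <= abs (m`!)%:R.
Proof.
move=> /pcharf0P charK.
(* If no positive integer has absolute value below 1, then neither has any factorial, and [q] = 1
   works. *)
have [[p0 ]|noP] := pselect (exists p, (0 < p)%N && (abs p%:R < 1)); last first.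
  exists 1 => // m; rewrite expr1n leNgt; apply/negP => m1.
  by apply: noP; exists (m`!)%N; rewrite fact_gt0.
move=> p0P; have exP : exists p, (0 < p)%N && (abs p%:R < 1) by exists p0.
have [p /andP[p_gt0 p1] pmin] := ex_minnP exP.
have p_gt1 : (1 < p)%N.
  rewrite ltn_neqAle p_gt0 andbT; apply: contraTneq p1 => <-.
  by rewrite abs1 ltxx.
have pK0 : 0 < abs p%:R by rewrite abs_gt0 // charK -lt0n.
have small r : (0 < r < p)%N -> abs r%:R = 1.
  move=> /andP[r0 rp]; apply/eqP; rewrite eq_le abs_natr_le1 leNgt.
  by apply/negP => r1; have := pmin r; rewrite r0 r1 leqNgt rp => /(_ isT).
(* Otherwise [r], as the difference of [p * k + r] and [p * k], would have absolute value below
   1. *)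
have unit k r : (0 < r < p)%N -> abs (p * k + r)%:R = 1.
  move=> rp; apply/eqP; rewrite eq_le abs_natr_le1 /= -(small r rp).
  rewrite leNgt; apply/negP => lt1.
  have : abs r%:R < 1; last by rewrite small ?ltxx.
  have -> : (r%:R : K) = (p * k + r)%:R + - (p * k)%:R.
    by rewrite natrD addrAC subrr add0r.
  apply: le_lt_trans (abs_ultrametric absK _ _) _.
  rewrite gt_max absN -{1}(small r rp) lt1 natrM (absM absK) /=.
  by rewrite (le_lt_trans _ p1) // ler_piMr ?abs_natr_le1 // ltW.
have block k r : (r < p)%N -> abs ((p * k + r)`!)%:R = abs ((p * k)`!)%:R.
  elim: r => [|r IH] rp; first by rewrite addn0.
  by rewrite addnS factS natrM (absM absK) -addnS unit // mul1r IH // ltnW.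
have mult k : abs ((p * k)`!)%:R = abs p%:R ^+ k * abs (k`!)%:R.
  elim: k => [|k IH]; first by rewrite muln0 expr0 mul1r.
  have E : (p * k.+1 = (p * k + p.-1).+1)%N.
    by rewrite mulnS addnC -addnS prednK.
  rewrite {1}E factS -E natrM (absM absK) block ?prednK // IH.
  by rewrite natrM (absM absK) factS natrM (absM absK) exprS mulrACA.
exists (abs p%:R) => // m; elim/ltn_ind: m => m IH.
have [->|m0] := posnP m; first by rewrite abs1.
rewrite {2}(divn_eq m p) mulnC block ?ltn_mod // mult.
have lt : (m %/ p < m)%N by rewrite ltn_Pdiv.
(* With k = [m %/ p], induction gives |k!| >= |p|^k, so |m!| >= |p|^(2k); and 2k <= pk <= m. *)
apply: le_trans (_ : abs p%:R ^+ (m %/ p) * abs p%:R ^+ (m %/ p) <= _).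
  rewrite -exprD ler_wiXn2l ?ltW // addnn -muln2.
  by apply: leq_trans (leq_trunc_div m p); rewrite leq_mul2l p_gt1 orbT.
by rewrite ler_pM2l ?exprn_gt0 // IH.
Qed.

End NonarchAbs.

(** * Recursion in the order of t for the coefficients of the flow *)

Section FlowCoefficients.
Variables (K : fieldType) (v : fps K) (a : fps (fps K)).
Hypothesis flow : is_formal_flow v a.

Lemma formal_flow_coefS n m :
  a n m.+1 * m.+1%:R = \sum_(k < n.+1) v k * (a ^+ k) n m.
Proof.
have /fpsP/(_ n)/fpsP/(_ m) := formal_flow_ode flow.
rewrite /= coef_fps_sum mulr_natr => ->.
by apply: eq_bigr => k _; rewrite coef_fpsCM.
Qed.

Lemma formal_flow_coef0 n : a n 0%N = (n == 1%N)%:R.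
Proof. by have /fpsP/(_ n) := formal_flow_init flow. Qed.

(** The x-linear part of the flow equation is a_1' = b_1 a_1 with a_1(0) = 1, so a_1 = exp(b_1
    t). *)
Lemma formal_flow_coef1 m : v 0%N = 0 -> a 1%N m * (m`!)%:R = v 1%N ^+ m.
Proof.
move=> v0; elim: m => [|m IH]; first by rewrite formal_flow_coef0 mulr1.
rewrite factS natrM mulrA formal_flow_coefS 2!big_ord_recl big_ord0 /= v0.
by rewrite mul0r add0r addr0 expr1 -mulrA IH exprS.
Qed.

End FlowCoefficients.

(** * Vanishing of b_1 and weighted bounds for the flow and its powers *)

Section FlowBound.
Context {R : realType} {K : fieldType} {abs : K -> R}.
Hypothesis absK : nonarch_absolute_value abs.

(* At [t = 1 / b_1] the terms of [a_1(t)] are the [1 / m!], of absolute value at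
   least 1. *)
Lemma flow_multiplier_eq0 (v : fps K) (a : fps (fps K)) :
  [pchar K] =i pred0 -> v 0%N = 0 -> is_formal_flow v a ->
  (forall t, fps_converges_at abs (a 1%N) t) -> v 1%N = 0.
Proof.
move=> /pcharf0P charK v0 flow cva; apply/eqP/negPn/negP => v1.
have [l /(fps_has_value_terms_cvg0 absK)/(abs_cvg0P absK)] := cva (v 1%N)^-1.
move=> /(_ 1 ltr01)[N /(_ N (leqnn N))]; apply/negP; rewrite -leNgt.
have fN : (N`!)%:R != 0 :> K by rewrite charK -lt0n fact_gt0.
have -> : a 1%N N = v 1%N ^+ N / (N`!)%:R.
  by rewrite -(formal_flow_coef1 _ _ _ flow _ v0) mulfK.
rewrite mulrAC exprVn divff ?expf_neq0 // mul1r (absV absK).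
by rewrite invf_ge1 ?(abs_gt0 absK) // (abs_natr_le1 absK).
Qed.

(* For the k-th power of the flow; the value 0 records that its n-th coefficient
   has degree at most n - k in t. *)
Definition flow_weight (c M : R) (k n m : nat) : R :=
  if (m + k <= n)%N then c ^+ (n - k) * M ^+ m else 0.

Lemma flow_weight_ge0 c M k n m :
  0 <= c -> 0 <= M -> 0 <= flow_weight c M k n m.
Proof.
move=> c0 M0; rewrite /flow_weight; case: ifP => // _.
by rewrite mulr_ge0 ?exprn_ge0.
Qed.

Lemma flow_weightM c M k1 k2 n1 n2 m1 m2 : 0 <= c -> 0 <= M ->
  flow_weight c M k1 n1 m1 * flow_weight c M k2 n2 m2 <=
  flow_weight c M (k1 + k2) (n1 + n2) (m1 + m2).
Proof.
move=> c0 M0; rewrite {1 2}/flow_weight.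
case: ifP => [h1|_]; last by rewrite mul0r flow_weight_ge0.
case: ifP => [h2|_]; last by rewrite mulr0 flow_weight_ge0.
rewrite /flow_weight addnACA leq_add // mulrACA -!exprD.
by have -> : (n1 - k1 + (n2 - k2) = n1 + n2 - (k1 + k2))%N by lia.
Qed.

(** The cutoff [N] on the order in t lets an induction on [N] apply the bound to powers of a flow
    controlled only up to that order. *)
Definition flow_bounded (N : nat) (c M : R) (k : nat) (f : fps (fps K)) :=
  forall n m, (m <= N)%N -> abs (f n m) * abs (m`!)%:R <= flow_weight c M k n m.

Section Weighted.
Variables (c M : R) (N : nat).
Hypotheses (c0 : 0 <= c) (M0 : 0 <= M).

Lemma flow_bounded1 : flow_bounded N c M 0 1.
Proof.
move=> n m _; rewrite coef_fps1; case: eqP => [->|_]; last first.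
  by rewrite mulr0n (abs0 absK) mul0r flow_weight_ge0.
rewrite mulr1n coef_fps1; case: eqP => [->|_]; last first.
  by rewrite mulr0n (abs0 absK) mul0r flow_weight_ge0.
by rewrite mulr1n (abs1 absK) /flow_weight /= mulr1.
Qed.

(* The factorials turn the Cauchy product in [t] into a binomial convolution,
   whose coefficients have absolute value at most 1. *)
Lemma flow_boundedM k l f g :
  flow_bounded N c M k f -> flow_bounded N c M l g ->
  flow_bounded N c M (k + l) (f * g).
Proof.
move=> fk gl n m mN; rewrite -(absM absK) coef_fpsM coef_fps_sum mulr_suml.
apply: (abs_sum_le absK) => [|i _]; first exact: flow_weight_ge0.
rewrite coef_fpsM mulr_suml.
apply: (abs_sum_le absK) => [|j _]; first exact: flow_weight_ge0.
have [jm ni] := (leq_ord j, leq_ord i).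
rewrite -(bin_fact jm) !natrM.
rewrite mulrCA [X in abs (_ * X)]mulrACA (absM absK).
apply: le_trans (_ : abs (f i j * (j`!)%:R *
                          (g (n - i)%N (m - j)%N * ((m - j)`!)%:R)) <= _).
  by rewrite ler_piMl ?(abs_ge0 absK) // (abs_natr_le1 absK).
rewrite !(absM absK).
have := flow_weightM c M k l i (n - i) j (m - j) c0 M0; rewrite !subnKC //.
apply: le_trans; apply: ler_pM; rewrite ?mulr_ge0 ?(abs_ge0 absK) //.
  exact: fk _ _ (leq_trans jm mN).
exact: gl _ _ (leq_trans (leq_subr _ _) mN).
Qed.

Lemma flow_boundedX f k :
  flow_bounded N c M 1 f -> flow_bounded N c M k (f ^+ k).
Proof.
move=> f1; elim: k => [|k IH]; first exact: flow_bounded1.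
by rewrite exprS -add1n; exact: flow_boundedM.
Qed.

End Weighted.

(** The flow equation expresses order [N.+1] in t through order [N] of the powers [a ^+ k], and B
    c^k * c^(n-k) (Bc)^N = c^(n-1) (Bc)^(N+1). *)
Lemma formal_flow_bounded (v : fps K) (a : fps (fps K)) (B c : R) N :
  0 < B -> 0 < c -> v 0%N = 0 -> v 1%N = 0 ->
  (forall n, abs (v n) <= B * c ^+ n) -> is_formal_flow v a ->
  flow_bounded N c (B * c) 1 a.
Proof.
move=> B0 c0 v0 v1 vB flow; elim: N => [|N IH] n m.
  rewrite leqn0 => /eqP ->; rewrite (formal_flow_coef0 _ _ _ flow) (abs1 absK).
  rewrite mulr1 /flow_weight; case: eqP => [->|_] /=.
    by rewrite (abs1 absK) mulr1.
  rewrite (abs0 absK); case: ifP => // _.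
  by rewrite mulr1 exprn_ge0 // ltW.
rewrite leq_eqVlt => /predU1P[->|]; last exact: IH.
have [cge0 Mge0] : 0 <= c /\ 0 <= B * c by rewrite mulr_ge0 !ltW.
rewrite factS natrM -(absM absK) mulrA (formal_flow_coefS _ _ _ flow) mulr_suml.
apply: (abs_sum_le absK) => [|k _]; first exact: flow_weight_ge0.
rewrite -mulrA !(absM absK).
have := flow_boundedX c (B * c) N cge0 Mge0 a k IH n N (leqnn N).
(* Only exponents at least 2 survive, as b_0 = b_1 = 0; hence the degree condition [N + k.+2 <= n]
   yields [N.+1 + 1 <= n]. *)
case: k => -[|[|k]] kn /=; rewrite ?v0 ?v1 ?(abs0 absK) ?mul0r.
- by rewrite flow_weight_ge0.
- by rewrite flow_weight_ge0.
move=> ak; apply: le_trans (ler_pM _ _ (vB k.+2) ak) _.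
- exact: (abs_ge0 absK).
- by rewrite mulr_ge0 ?(abs_ge0 absK).
rewrite /flow_weight; case: ifP => [Nk|_]; last first.
  by rewrite mulr0; exact: flow_weight_ge0.
have -> : (N.+1 + 1 <= n)%N.
  by apply: leq_trans Nk; rewrite addn1 !addnS !ltnS leq_addr.
have -> : (n - 1 = k.+1 + (n - k.+2))%N by lia.
by rewrite exprD !exprS le_eqVlt; apply/orP; left; apply/eqP; ring.
Qed.

End FlowBound.

(** * From the coefficient bound to a positive radius of convergence *)

Theorem theorem1p2 (R : realType) (K : fieldType) (abs : K -> R)
    (charK : [pchar K] =i pred0)
    (absK : nonarch_absolute_value abs)
    (abs_nontrivial : nontrivial_abs abs)
    (abs_complete : complete_abs abs)
    (v : fps K) (v_no_cst : v 0%N = 0) (v_analytic : fps_analytic abs v)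
    (T : K -> fps K) (flowT : generates_formal_flow abs v T) :
  forall t : K, fps_analytic abs (T t).
Proof.
have [a [flow aT _ _]] := flowT.
have v1 : v 1%N = 0.
  apply: (flow_multiplier_eq0 absK v a charK v_no_cst flow) => t.
  by exists (T t 1%N).
have [B [c [B0 c0 vB]]] :=
  fps_analytic_geometric_bound absK v abs_nontrivial v_analytic.
have [q q0 qfact] := abs_fact_ge absK charK.
(* The terms of a_n(t) are at most c^(n-1) (Bc|t|/q)^m with m < n; bases at least 1 allow both
   exponents to be raised to n. *)
move=> t; pose E := Num.max 1 (B * c * abs t / q); pose C := Num.max 1 c.
have E1 : 1 <= E by rewrite le_max lexx.
have C1 : 1 <= C by rewrite le_max lexx.
have [E0 C0] : 0 < E /\ 0 < C by rewrite !(lt_le_trans ltr01).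
apply: (@fps_analytic_of_geometric_bound _ _ _ absK _ (C * E)) => //.
  exact: mulr_gt0.
(* A bound uniform in [m] on the terms passes to the sum of the series. *)
move=> n; apply: (fps_has_value_le absK (a n) t) (aT n t) => m.
have := formal_flow_bounded absK v a B c m B0 c0 v_no_cst v1 vB flow n m
  (leqnn m).
have m0 : 0 < abs (m`!)%:R by rewrite (lt_le_trans _ (qfact m)) ?exprn_gt0.
rewrite -ler_pdivlMr // (absM absK) (absX absK) => am.
apply: le_trans (ler_wpM2r (exprn_ge0 m (abs_ge0 absK t)) am) _.
rewrite /flow_weight; case: ifP => [mn|_]; last first.
  by rewrite !mul0r exprn_ge0 // mulr_ge0 ?ltW.
rewrite [X in _ <= X]exprMn -2!mulrA; apply: ler_pM.
- by rewrite exprn_ge0 // ltW.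
- by rewrite !mulr_ge0 ?invr_ge0 ?exprn_ge0 ?mulr_ge0 ?(abs_ge0 absK) ?ltW.
- apply: le_trans (_ : C ^+ (n - 1) <= _).
    by apply: lerXn2r; rewrite ?nnegrE ?le_max ?lexx ?orbT ?ltW.
  by rewrite ler_weXn2l // leq_subr.
apply: le_trans (_ : E ^+ m <= _); last first.
  by rewrite ler_weXn2l // (leq_trans _ mn) ?leq_addr.
apply: le_trans (_ : (B * c * abs t / q) ^+ m <= _); last first.
  apply: lerXn2r; rewrite ?nnegrE ?(ltW E0) ?le_max ?lexx ?orbT //.
  by rewrite divr_ge0 ?mulr_ge0 ?(abs_ge0 absK) ?ltW.
have -> : (B * c * abs t / q) ^+ m = (B * c) ^+ m * ((q ^+ m)^-1 * abs t ^+ m).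
  by rewrite !exprMn exprVn; ring.
rewrite ler_wpM2l ?exprn_ge0 ?mulr_ge0 ?(ltW B0) ?(ltW c0) //.
by rewrite ler_wpM2r ?exprn_ge0 ?(abs_ge0 absK) // lef_pV2 ?posrE ?exprn_gt0.
Qed.
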